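(* The map $\Phi:P_-\to T^+S^3$, $$\Phi(q,v)=\big(\alpha\sin\varphi+\beta\cos\varphi,\ \nu(-\alpha\cos\varphi+\beta\sin\varphi)\big),\qquad\varphi=\alpha_0,$$ defined on $P_-=\{(q,v)\in TS^3:q_0\ne\pm1,\ E(q,v)<0\}$, is not symplectic.
   Context: Notation: $\langle\cdot,\cdot\rangle$ is the Euclidean inner product on $\mathbb{R}^4$; $\cdot$, $|\cdot|$ are the dot product and norm on $\mathbb{R}^3$. Write $q=(q_0,\boldsymbol q)$, $v=(v_0,\boldsymbol v)\in\mathbb{R}\times\mathbb{R}^3$, and $TS^3=\{(q,v): \langle q,q\rangle=1,\ \langle q,v\rangle=0\}$ with symplectic form the restriction of $\sum_{i=0}^3dq_i\wedge dv_i$. Fix $\gamma>0$. Set $\boldsymbol\pi=q_0\boldsymbol v-v_0\boldsymbol q$ and $E=\frac12|\boldsymbol\pi|^2-\gamma\frac{q_0}{|\boldsymbol q|}$; $E<0$ forces $q_0>0$. Where $E<0$, set $\nu=\gamma/\sqrt{-2E}$ and $$\alpha=(\alpha_0,\boldsymbol\alpha)=\Big(\frac{1}{\nu q_0}\,\boldsymbol q\cdot\boldsymbol\pi,\ \frac{\boldsymbol q}{|\boldsymbol q|}-\frac{\boldsymbol q\cdot\boldsymbol\pi}{\gamma q_0}\boldsymbol\pi\Big),\qquad \beta=(\beta_0,\boldsymbol\beta)=\Big(\frac{|\boldsymbol q|}{\gamma q_0}\boldsymbol\pi\cdot\boldsymbol\pi-1,\ \frac{|\boldsymbol q|}{\nu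 q_0}\boldsymbol\pi\Big).$$ $T^+S^3=\{(x,y)\in\mathbb{R}^4\times\mathbb{R}^4:\langle x,x\rangle=1,\langle x,y\rangle=0,y\neq0\}$ carries the symplectic form $\tilde\omega$ that is the restriction of $\sum_{i=0}^3dx_i\wedge dy_i$. *)

(* Defs.v *)
From HB Require Import structures.
From mathcomp Require Import all_boot all_order all_algebra.
From mathcomp Require Import all_classical all_reals all_analysis.
Set Implicit Arguments.
Unset Strict Implicit.
Unset Printing Implicit Defensive.
Import Order.TTheory GRing.Theory Num.Theory.
Import numFieldNormedType.Exports.
Local Open Scope classical_set_scope.
Local Open Scope ring_scope.

Definition dot (R : realType) (n : nat) (u v : 'rV[R]_n) : R :=
  \sum_(i < n) u 0 i * v 0 i.

(* The library norm [`|u|] of a row vector is the sup norm, hence this one. *)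
Definition enorm (R : realType) (n : nat) (u : 'rV[R]_n) : R :=
  Num.sqrt (dot u u).

Definition R8 (R : realType) : normedModType R :=
  ('rV[R]_4 * 'rV[R]_4)%type.

(* [q = row4 q0 qv] with [q0 = scal q] and [qv = vect q]. *)
Definition scal (R : realType) (q : 'rV[R]_4) : R := q 0 0.

Definition vect (R : realType) (q : 'rV[R]_4) : 'rV[R]_3 :=
  rsubmx (q : 'rV[R]_(1 + 3)).

Definition row4 (R : realType) (x0 : R) (x : 'rV[R]_3) : 'rV[R]_4 :=
  row_mx (x0%:M : 'rV[R]_1) x.

(* [\sum_i dx_i /\ dy_i] on R^8, evaluated on a pair of vectors; both
   symplectic forms below are restrictions of it. *)
Definition omega (R : realType) (u w : R8 R) : R :=
  dot u.1 w.2 - dot w.1 u.2.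

Definition TS3 (R : realType) : set (R8 R) :=
  [set p | dot p.1 p.1 = 1 /\ dot p.1 p.2 = 0].

Definition TplusS3 (R : realType) : set (R8 R) :=
  [set p | [/\ dot p.1 p.1 = 1, dot p.1 p.2 = 0 & p.2 <> 0]].

(* Tangent vectors of an embedded submanifold [M] at [p], as velocities of
   curves in [M] through [p]. *)
Definition tangent (R : realType) (M : set (R8 R)) (p u : R8 R) : Prop :=
  exists c : R -> R8 R,
    [/\ c 0 = p, \forall t \near (0 : R), M (c t) & is_derive (0 : R) 1 c u].

(* A map from [M] to [N] is given by a function on the ambient R^8 that is
   differentiable at the points of [M]; on vectors tangent to [M] its
   differential depends only on the restriction of [f] to [M]. *)
Definition symplectic_map (R : realType) (M N : set (R8 R))
    (f : R8 R -> R8 R) : Prop :=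
  [/\ forall p, M p -> N (f p),
      forall p, M p -> differentiable f p &
      forall p u w, M p -> tangent M p u -> tangent M p w ->
        omega ('d f p u) ('d f p w) = omega u w].

Section Kepler.
Variables (R : realType) (gamma : R).
Implicit Types p : R8 R.

Definition momentum p : 'rV[R]_3 :=
  scal p.1 *: vect p.2 - scal p.2 *: vect p.1.

Definition energy p : R :=
  2^-1 * enorm (momentum p) ^+ 2 - gamma * (scal p.1 / enorm (vect p.1)).

Definition nu p : R := gamma / Num.sqrt (- (2 * energy p)).

Definition alpha0 p : R :=
  (nu p * scal p.1)^-1 * dot (vect p.1) (momentum p).

Definition alphav p : 'rV[R]_3 :=
  (enorm (vect p.1))^-1 *: vect p.1
  - (dot (vect p.1) (momentum p) / (gamma * scal p.1)) *: momentum p.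

Definition beta0 p : R :=
  enorm (vect p.1) / (gamma * scal p.1) * dot (momentum p) (momentum p) - 1.

Definition betav p : 'rV[R]_3 :=
  (enorm (vect p.1) / (nu p * scal p.1)) *: momentum p.

Definition alpha p : 'rV[R]_4 := row4 (alpha0 p) (alphav p).

Definition beta p : 'rV[R]_4 := row4 (beta0 p) (betav p).

(* [scal p.1 <> 1, -1] gives [vect p.1 <> 0], and [energy p < 0] then gives
   [0 < scal p.1], so every denominator above is nonzero on [Pminus]. *)
Definition Pminus : set (R8 R) :=
  [set p | [/\ TS3 p, scal p.1 <> 1, scal p.1 <> -1 & energy p < 0]].

Definition Phi p : R8 R :=
  let phi := alpha0 p in
  (sin phi *: alpha p + cos phi *: beta p,
   nu p *: (- (cos phi *: alpha p) + sin phi *: beta p)).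

End Kepler.

(* Main.v *)
Require Import Defs.
From HB Require Import structures.
From mathcomp Require Import all_boot all_order all_algebra.
From mathcomp Require Import all_classical all_reals all_analysis.
From mathcomp Require Import ring lra.
Import Order.TTheory GRing.Theory Num.Theory.
Import numFieldNormedType.Exports.
Local Open Scope classical_set_scope.
Local Open Scope ring_scope.

Set Implicit Arguments.
Unset Strict Implicit.
Unset Printing Implicit Defensive.

(** In the gnomonic coordinate x = q_vec / q0 on the upper hemisphere, the
    quantities alpha, beta and nu are those of the Kepler problem in R^3 with
    position x, momentum pi and energy |pi|^2 / 2 - gamma / |x|. So Phi is
    the Ligon-Schaaf map, which is symplectic for the form sum dx_i /\ dpi_i,
    precomposed with (q, v) |-> (x, pi). The latter is not canonical: the
    Poisson bracket of x_i and pi_j is delta_ij + x_i x_j, so Phi distorts the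
    symplectic form wherever x is nonzero.

    The distortion already shows on motions along one great circle through the
    pole (radial motions), where everything is explicit. With
    q = (cos theta, sin theta e) and v = s (- sin theta, cos theta e) one finds
    x = tan theta and pi = s, hence dx /\ dpi = sec^2 theta dtheta /\ ds, while
    the form on TS^3 restricts to dtheta /\ ds. At rest (s = 0) at the angle
    theta = pi/4 the two differ by the factor 2, and [omega_Phi] finds this
    factor from the definitions alone. It needs few derivatives: when theta
    varies at s = 0, Phi is ((-1, 0), - nu (0, e)) ([Phi_rest]), so only nu
    varies, and its derivative ([is_derive_rest_coord]) has to be paired with just
    one coordinate of the derivative in the direction s ([vect_Phi_moving],
    [is_derive_moving_coord]).

    That Phi takes its values in T^+S^3 amounts to alpha, beta being
    orthonormal, which is the relation nu^2 (2 gamma q0 / |q_vec| - |pi|^2)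
    = gamma^2 ([nu_sqr]) between nu and the energy; Phi is differentiable
    since q0, |q_vec| and - 2 E are positive on P_-. *)

(** * Dot products and the splitting of R^4 *)

Section Dot.
Context (R : realType) (n : nat).
Implicit Types (u v w : 'rV[R]_n) (k : R).

Lemma dotC u v : dot u v = dot v u.
Proof. by apply: eq_bigr => i _; rewrite mulrC. Qed.

Lemma dotDl u v w : dot (u + v) w = dot u w + dot v w.
Proof. by rewrite -big_split; apply: eq_bigr => i _; rewrite mxE mulrDl. Qed.

Lemma dotZl k u v : dot (k *: u) v = k * dot u v.
Proof. by rewrite /dot mulr_sumr; apply: eq_bigr => i _; rewrite mxE mulrA. Qed.

Lemma dotNl u v : dot (- u) v = - dot u v.
Proof. by rewrite -scaleN1r dotZl mulN1r. Qed.

Lemma dotDr u v w : dot u (v + w) = dot u v + dot u w.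
Proof. by rewrite dotC dotDl !(dotC u). Qed.

Lemma dotZr k u v : dot u (k *: v) = k * dot u v.
Proof. by rewrite dotC dotZl dotC. Qed.

Lemma dotNr u v : dot u (- v) = - dot u v.
Proof. by rewrite dotC dotNl dotC. Qed.

Lemma dot0r u : dot u 0 = 0.
Proof. by rewrite -(scale0r 0) dotZr mul0r. Qed.

Lemma dot_ge0 u : 0 <= dot u u.
Proof. by apply: sumr_ge0 => i _; rewrite -expr2 sqr_ge0. Qed.

Lemma enorm_sqr u : enorm u ^+ 2 = dot u u.
Proof. by rewrite sqr_sqrtr // dot_ge0. Qed.

Lemma enorm_gt0 u : (0 < enorm u) = (0 < dot u u).
Proof. by rewrite sqrtr_gt0. Qed.
End Dot.

Section Row4.
Context (R : realType).

Lemma scal_row4 (x : R) v : scal (row4 x v) = x.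
Proof.
rewrite /scal /row4 (_ : (0 : 'I_4) = lshift 3 (0 : 'I_1)); last exact: val_inj.
by rewrite (@row_mxEl _ 1 1 3) !mxE.
Qed.

Lemma vect_row4 (x : R) v : vect (row4 x v) = v.
Proof. exact: row_mxKr. Qed.

Lemma row4_eta (q : 'rV[R]_4) : row4 (scal q) (vect q) = q.
Proof.
rewrite /row4 /vect -[RHS](@hsubmxK _ _ 1 3); congr (@row_mx _ 1 1 3 _ _).
rewrite [RHS]mx11_scalar; congr _%:M.
by rewrite mxE /scal; congr (q 0 _); apply: val_inj.
Qed.

Lemma row4Z k (x : R) v : k *: row4 x v = row4 (k * x) (k *: v).
Proof. by rewrite /row4 (@scale_row_mx _ 1 1 3) scale_scalar_mx. Qed.

Lemma row4D (x y : R) u v : row4 x u + row4 y v = row4 (x + y) (u + v).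
Proof. by rewrite /row4 (@add_row_mx _ 1 1 3) raddfD. Qed.

Lemma dot_row4 (x y : R) u v : dot (row4 x u) (row4 y v) = x * y + dot u v.
Proof.
rewrite /dot (@big_split_ord _ _ _ 1 3) big_ord1 /row4.
rewrite !(@row_mxEl _ 1 1 3) !mxE; congr (_ + _).
by apply: eq_bigr => i _; rewrite !(@row_mxEr _ 1 1 3).
Qed.

Lemma dot4E (p q : 'rV[R]_4) : dot p q = scal p * scal q + dot (vect p) (vect q).
Proof. by rewrite -{1}(row4_eta p) -{1}(row4_eta q) dot_row4. Qed.

End Row4.

(** * Differentiability of vector-valued functions *)

Section Diff.
Context (R : realType) (V : normedModType R).
Implicit Types (x : V).

Lemma differentiable_mx m n (M : V -> 'M[R]_(m, n)) x :
  (forall i j, differentiable (fun y => M y i j) x) -> differentiable M x.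
Proof.
move=> dM.
have -> : M = \sum_(i < m) \sum_(j < n) (fun y => M y i j *: delta_mx i j).
  apply/funext => y; rewrite [LHS]matrix_sum_delta fct_sumE.
  by apply: eq_bigr => i _; rewrite fct_sumE.
by do 2![apply: differentiable_sum => ?]; apply: differentiableZl.
Qed.

Lemma differentiable_entry m n (M : V -> 'M[R]_(m, n)) i j x :
  differentiable M x -> differentiable (fun y => M y i j) x.
Proof.
move=> dM; apply: (@differentiable_comp _ _ _ _ M (fun N : 'M[R]_(m, n) => N i j)) => //.
exact: differentiable_coord.
Qed.

Lemma differentiable_scalemx m n (k : V -> R) (M : V -> 'M[R]_(m, n)) x :
  differentiable k x -> differentiable M x ->
  differentiable (fun y => k y *: M y) x.
Proof.
move=> dk dM; apply: differentiable_mx => i j.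
rewrite (_ : (fun y => _) = k * (fun y => M y i j)); last first.
  by apply/funext => y; rewrite mxE.
by apply: differentiableM => //; exact: differentiable_entry.
Qed.

Lemma differentiable_dot n (f g : V -> 'rV[R]_n) x :
  differentiable f x -> differentiable g x ->
  differentiable (fun y => dot (f y) (g y)) x.
Proof.
move=> df dg; rewrite (_ : (fun y => _) =
   \sum_(i < n) ((fun y => f y 0 i) * (fun y => g y 0 i))); last first.
  by apply/funext => y; rewrite fct_sumE.
apply: differentiable_sum => i.
by apply: differentiableM; exact: differentiable_entry.
Qed.

Lemma differentiable_sqrt (f : V -> R) x : 0 < f x -> differentiable f x ->
  differentiable (fun y => Num.sqrt (f y)) x.
Proof.
move=> f0 df; apply: (differentiable_comp df).
by apply/derivable1_diffP; have [] := is_derive1_sqrt f0.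
Qed.

Lemma differentiable_enorm n (f : V -> 'rV[R]_n) x : 0 < enorm (f x) ->
  differentiable f x -> differentiable (fun y => enorm (f y)) x.
Proof.
rewrite enorm_gt0 => f0 df; apply: differentiable_sqrt => //.
exact: differentiable_dot.
Qed.

Lemma differentiable_sin (f : V -> R) x : differentiable f x ->
  differentiable (fun y => sin (f y)) x.
Proof.
move=> df; apply: (differentiable_comp df).
by apply/derivable1_diffP; exact: derivable_sin.
Qed.

Lemma differentiable_cos (f : V -> R) x : differentiable f x ->
  differentiable (fun y => cos (f y)) x.
Proof.
move=> df; apply: (differentiable_comp df).
by apply/derivable1_diffP; exact: derivable_cos.
Qed.

Lemma differentiable_div (f g : V -> R) x : g x != 0 ->
  differentiable f x -> differentiable g x ->
  differentiable (fun y => f y / g y) x.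
Proof.
move=> g0 df dg; apply: (differentiableM df).
exact: (differentiableV dg g0).
Qed.

Lemma differentiable_scal (f : V -> 'rV[R]_4) x : differentiable f x ->
  differentiable (fun y => scal (f y)) x.
Proof. exact: differentiable_entry. Qed.

Lemma differentiable_vect (f : V -> 'rV[R]_4) x : differentiable f x ->
  differentiable (fun y => vect (f y)) x.
Proof.
move=> df; apply: (differentiable_comp df).
exact: (@differentiable_rsubmx R 1 1 3).
Qed.

Lemma differentiable_row4 (f : V -> R) (g : V -> 'rV[R]_3) x :
  differentiable f x -> differentiable g x ->
  differentiable (fun y => row4 (f y) (g y)) x.
Proof.
move=> df dg; apply: differentiable_mx => i j; rewrite ord1.
case: (@split_ordP 1 3 j) => k ->.
  rewrite (_ : (fun y => _) = f) //; apply/funext => y.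
  by rewrite /row4 (@row_mxEl _ 1 1 3) ord1 mxE.
rewrite (_ : (fun y => _) = fun y => g y 0 k); last first.
  by apply/funext => y; rewrite /row4 (@row_mxEr _ 1 1 3).
exact: differentiable_entry.
Qed.

Lemma is_derive_scalel (k : R -> R) (v : V) (t dk : R) :
  is_derive t 1 k dk -> is_derive t 1 (fun s => k s *: v) (dk *: v).
Proof.
move=> [/derivable1_diffP dkt <-]; apply: DeriveDef.
  by apply/derivable1_diffP; exact: differentiableZl.
by rewrite !deriveE ?diffZl//; apply: (@differentiableZl _ _ _ k v t dkt).
Qed.

(** Replaces the values of a differential, which have no formula, by ordinary
    derivatives along straight lines. Such a line may leave the submanifold on
    which the function is of interest. *)
Lemma is_derive_line (W : normedModType R) (f : V -> W) x u :
  differentiable f x ->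
  is_derive (0 : R) 1 (fun t => f (t *: u + x)) ('d f x u).
Proof.
move=> df; apply: DeriveDef; first exact: (derivable1P f x u).1 (diff_derivable df).
rewrite -deriveE// /derive; apply: (congr1 (fun g : R -> W => lim (g @ 0^'))).
apply/funext => h /=.
by rewrite addr0 scale0r add0r [_%:A]mulr1.
Qed.

Lemma diff_entry m n (M : V -> 'M[R]_(m, n)) i j x u : differentiable M x ->
  'd (fun y => M y i j) x u = ('d M x u) i j.
Proof.
move=> dM; rewrite -deriveE; last exact: differentiable_entry.
by rewrite -deriveE // derive_mx ?mxE//; exact: diff_derivable.
Qed.

End Diff.

Section Pair.
Context (R : realType) (V W1 W2 : normedModType R).
Context (f : V -> (W1 * W2)%type) (x : V) (df : differentiable f x).

Lemma differentiable_fst : differentiable (fun y => (f y).1) x.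
Proof.
apply: (differentiable_comp df).
by apply: (@linear_differentiable _ _ _ fst) => y; exact: cvg_fst.
Qed.

Lemma differentiable_snd : differentiable (fun y => (f y).2) x.
Proof.
apply: (differentiable_comp df).
by apply: (@linear_differentiable _ _ _ snd) => y; exact: cvg_snd.
Qed.

Lemma diff_fst u : 'd (fun y => (f y).1) x u = ('d f x u).1.
Proof.
have fc : continuous (fst : W1 * W2 -> W1) by move=> y; exact: cvg_fst.
rewrite (diff_comp df) /=; last exact: (@linear_differentiable _ _ _ fst).
by rewrite (@diff_lin _ _ _ fst).
Qed.

Lemma diff_snd u : 'd (fun y => (f y).2) x u = ('d f x u).2.
Proof.
have fc : continuous (snd : W1 * W2 -> W2) by move=> y; exact: cvg_snd.
rewrite (diff_comp df) /=; last exact: (@linear_differentiable _ _ _ snd).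
by rewrite (@diff_lin _ _ _ snd).
Qed.
End Pair.

(** * Phi takes its values in the punctured cotangent bundle *)

Section Target.
Context (R : realType) (gamma : R) (gamma_gt0 : 0 < gamma).
Implicit Types p : R8 R.

Lemma dot_vect_gt0 p : TS3 p -> scal p.1 <> 1 -> scal p.1 <> -1 ->
  0 < dot (vect p.1) (vect p.1).
Proof.
move=> [q1 _] qn1 qnN1; rewrite lt_neqAle dot_ge0 andbT eq_sym.
apply/eqP => v0; move: q1; rewrite dot4E v0 addr0 -expr2 => /eqP.
by rewrite sqrf_eq1 => /orP[] /eqP.
Qed.

Lemma Pminus_enorm_gt0 p : Pminus gamma p -> 0 < enorm (vect p.1).
Proof. by case=> pT q1 qN1 _; rewrite enorm_gt0 dot_vect_gt0. Qed.

(** For q0 <= 0 both terms of the energy are nonnegative. *)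
Lemma Pminus_scal_gt0 p : Pminus gamma p -> 0 < scal p.1.
Proof.
move=> pP; have r0 := Pminus_enorm_gt0 pP; case: pP => _ _ _.
apply: contraTT; rewrite -!leNgt subr_ge0 => q0.
apply: (@le_trans _ _ 0); last by rewrite mulr_ge0 ?invr_ge0 ?sqr_ge0.
by rewrite mulr_ge0_le0 ?(ltW gamma_gt0)// mulr_le0_ge0// invr_ge0 ltW.
Qed.

Lemma nu_gt0 p : energy gamma p < 0 -> 0 < nu gamma p.
Proof. by move=> E0; rewrite divr_gt0// sqrtr_gt0 oppr_gt0 pmulr_rlt0. Qed.

(** The definition of nu cleared of its square root: the only way in which the
    energy enters the orthonormality of alpha and beta. *)
Lemma nu_sqr p : energy gamma p < 0 ->
  nu gamma p ^+ 2 * (2 * gamma * scal p.1 / enorm (vect p.1)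
    - dot (momentum p) (momentum p)) = gamma ^+ 2.
Proof.
move=> E0; have E0' : 0 < - (2 * energy gamma p) by rewrite oppr_gt0 pmulr_rlt0.
rewrite expr_div_n sqr_sqrtr ?(ltW E0')//.
have -> : 2 * gamma * scal p.1 / enorm (vect p.1)
    - dot (momentum p) (momentum p) = - (2 * energy gamma p).
  by rewrite /energy enorm_sqr; move: (enorm _)^-1 => s; field.
by rewrite divfK// gt_eqF.
Qed.

Section Frame.
Context (p : R8 R) (pP : Pminus gamma p).

Let r := enorm (vect p.1).
Let q0 := scal p.1.
Let P := dot (momentum p) (momentum p).
Let v := nu gamma p.

Let r0 : r != 0. Proof. by rewrite gt_eqF// Pminus_enorm_gt0. Qed.
Let q00 : q0 != 0. Proof. by rewrite gt_eqF// Pminus_scal_gt0. Qed.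
Let g0 : gamma != 0. Proof. by rewrite gt_eqF. Qed.
Let v0 : v != 0. Proof. by case: pP => _ _ _ E0; rewrite gt_eqF// nu_gt0. Qed.

Let v2 : v ^- 2 = (2 * gamma * q0 / r - P) / gamma ^+ 2.
Proof.
case: pP => _ _ _ /nu_sqr h.
apply: (@mulfI _ (v ^+ 2)); first by rewrite expf_neq0.
by rewrite mulrA h !divff// expf_neq0.
Qed.

Let rr : dot (vect p.1) (vect p.1) = r ^+ 2. Proof. by rewrite enorm_sqr. Qed.

Lemma dot_alpha_alpha : dot (alpha gamma p) (alpha gamma p) = 1.
Proof.
move: v2; rewrite dot_row4 /alpha0 /alphav -/r -/q0 -/v /P.
move: (momentum p) => m v2m.
rewrite !(dotDl, dotDr, dotNl, dotNr, dotZl, dotZr) [dot m (vect _)]dotC rr.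
move: (dot _ m) (dot m m) v2m => d k v2m.
have -> : (v * q0)^-1 * d * ((v * q0)^-1 * d) = v ^- 2 * (d / q0) ^+ 2.
  by field; rewrite q00 v0.
by rewrite v2m; field; rewrite r0 q00 g0.
Qed.

Lemma dot_beta_beta : dot (beta gamma p) (beta gamma p) = 1.
Proof.
move: v2; rewrite dot_row4 /beta0 /betav -/r -/q0 -/v /P.
rewrite !(dotZl, dotZr); move: (dot (momentum p) _) => k v2k.
have -> : r / (v * q0) * (r / (v * q0) * k) = v ^- 2 * ((r / q0) ^+ 2 * k).
  by field; rewrite q00 v0.
by rewrite v2k; field; rewrite r0 q00 g0.
Qed.

Lemma dot_alpha_beta : dot (alpha gamma p) (beta gamma p) = 0.
Proof.
rewrite dot_row4 /alpha0 /beta0 /alphav /betav -/r -/q0 -/v.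
move: (momentum p) => m; rewrite !(dotDl, dotNl, dotZl, dotZr).
by field; rewrite r0 q00 g0 v0.
Qed.
End Frame.

(** Phi is built from a rotation of the orthonormal pair (alpha, beta), its second
    component being scaled by nu, which is nonzero. *)
Lemma Phi_TplusS3 p : Pminus gamma p -> TplusS3 (Phi gamma p).
Proof.
move=> pP; have v0 : nu gamma p != 0 by case: pP => _ _ _ E0; rewrite gt_eqF// nu_gt0.
have aa := dot_alpha_alpha pP; have bb := dot_beta_beta pP.
have ab := dot_alpha_beta pP; have ba := ab; rewrite dotC in ba.
have s2 := sin2cos2 (alpha0 gamma p).
split; rewrite /Phi /=.
- rewrite !(dotDl, dotDr, dotZl, dotZr) aa bb ab ba; ring: s2.
- rewrite !(dotDl, dotDr, dotNr, dotZl, dotZr) aa bb ab ba; ring.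
- move=> /(congr1 (fun y => dot y y)); rewrite dot0r.
  rewrite !(dotDl, dotDr, dotNl, dotNr, dotZl, dotZr) aa bb ab ba => y0.
  by move: v0; rewrite -sqrf_eq0 -y0 => /eqP; apply; ring: s2.
Qed.
End Target.

(** * Differentiability of Phi *)

Section PhiDiff.
Context (R : realType) (gamma : R) (gamma_gt0 : 0 < gamma).
Context (p : R8 R) (pP : Pminus gamma p).

Let did : differentiable (fun y : R8 R => y) p.
Proof. by have [] := is_diff_id p. Qed.

Let dfst := differentiable_fst did.
Let dsnd := differentiable_snd did.

Let q00 : scal p.1 != 0. Proof. by rewrite gt_eqF// (Pminus_scal_gt0 gamma_gt0). Qed.
Let r0 : 0 < enorm (vect p.1). Proof. exact: Pminus_enorm_gt0 pP. Qed.
Let g0 : gamma != 0. Proof. by rewrite gt_eqF. Qed.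
Let E0 : energy gamma p < 0. Proof. by case: pP. Qed.
Let v0 : nu gamma p != 0. Proof. by rewrite gt_eqF// nu_gt0. Qed.

Let dscal1 := differentiable_scal dfst.
Let dscal2 := differentiable_scal dsnd.
Let dvect1 := differentiable_vect dfst.
Let dvect2 := differentiable_vect dsnd.

Let dmomentum : differentiable (@momentum R) p.
Proof. by apply: differentiableB; exact: differentiable_scalemx. Qed.

Let denorm : differentiable (fun y : R8 R => enorm (vect y.1)) p.
Proof. exact: differentiable_enorm. Qed.

Let dmomentum2 : differentiable (fun y : R8 R => dot (momentum y) (momentum y)) p.
Proof. exact: differentiable_dot. Qed.

Let denergy : differentiable (energy gamma) p.
Proof.
rewrite (_ : energy gamma = fun y =>
  2^-1 * dot (momentum y) (momentum y) - gamma * (scal y.1 / enorm (vect y.1))).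
  apply: differentiableB; apply: differentiableM => //.
  by apply: differentiable_div => //; rewrite gt_eqF.
by apply/funext => y; rewrite -enorm_sqr.
Qed.

Let dnu : differentiable (nu gamma) p.
Proof.
have E2 : 0 < - (2 * energy gamma p) by rewrite oppr_gt0 pmulr_rlt0.
apply: differentiable_div => //; first by rewrite gt_eqF// sqrtr_gt0.
apply: differentiable_sqrt => //; apply: differentiableN.
exact: differentiableM.
Qed.

Let dalpha0 : differentiable (alpha0 gamma) p.
Proof.
apply: differentiableM; last exact: differentiable_dot.
by apply: differentiableV; [exact: differentiableM|rewrite mulf_neq0].
Qed.

Let dalpha : differentiable (alpha gamma) p.
Proof.
apply: differentiable_row4 => //; apply: differentiableB.
  by apply: differentiable_scalemx => //; apply: differentiableV => //; rewrite gt_eqF.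
apply: differentiable_scalemx => //; apply: differentiable_div.
- by rewrite mulf_neq0.
- exact: differentiable_dot.
- exact: differentiableM.
Qed.

Let dbeta : differentiable (beta gamma) p.
Proof.
apply: differentiable_row4.
  apply: differentiableB => //; apply: differentiableM => //.
  apply: differentiable_div => //; first by rewrite mulf_neq0.
  exact: differentiableM.
apply: differentiable_scalemx => //; apply: differentiable_div => //.
  by rewrite mulf_neq0.
exact: differentiableM.
Qed.

Lemma differentiable_Phi : differentiable (Phi gamma) p.
Proof.
have dsin := differentiable_sin dalpha0.
have dcos := differentiable_cos dalpha0.
apply: differentiable_pair.
  by apply: differentiableD; exact: differentiable_scalemx.
apply: differentiable_scalemx => //; apply: differentiableD.
  by apply: differentiableN; exact: differentiable_scalemx.
exact: differentiable_scalemx.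
Qed.

End PhiDiff.

(** * Radial motions *)

Section Planar.
Context (R : realType) (gamma : R) (gamma_gt0 : 0 < gamma).

Definition axis : 'rV[R]_3 := delta_mx 0 0.

Lemma dot_axis (v : 'rV[R]_3) : dot v axis = v 0 0.
Proof.
rewrite /dot big_ord_recl big1 => [|i _]; last by rewrite mxE mulr0.
by rewrite mxE mulr1 addr0.
Qed.

Lemma dot_axis_axis : dot axis axis = 1.
Proof. by rewrite dot_axis mxE. Qed.

Lemma enorm_axis (y : R) : 0 < y -> enorm (y *: axis) = y.
Proof.
move=> y0; rewrite /enorm dotZl dotZr dot_axis_axis mulr1 -expr2.
by rewrite sqrtr_sqr gtr0_norm.
Qed.

Lemma momentum_planar (x y z t : R) :
  momentum (row4 x (y *: axis), row4 z (t *: axis)) = (x * t - z * y) *: axis.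
Proof.
by rewrite /momentum !scal_row4 !vect_row4 !scalerA -scalerBl.
Qed.

Lemma row40 : row4 0 0 = 0 :> 'rV[R]_4.
Proof. by rewrite -[RHS](scale0r (row4 0 0)) row4Z mul0r scaler0. Qed.

Lemma momentum_rest (q : 'rV[R]_4) : momentum (q, 0) = 0.
Proof. by rewrite /momentum /= -row40 scal_row4 vect_row4 scaler0 scale0r subr0. Qed.

(** At rest the momentum and the phase vanish, so that alpha = (0, e) and
    beta = (-1, 0): only the length nu of the second component depends on the
    position along the ray. *)
Lemma Phi_rest (x y : R) : 0 < y ->
  Phi gamma (row4 x (y *: axis), 0)
  = (row4 (-1) 0, - (gamma / Num.sqrt (2 * gamma * (x / y))) *: row4 0 axis).
Proof.
move=> y0; set p := (_, _).
have a0 : alpha0 gamma p = 0 by rewrite /alpha0 momentum_rest dot0r mulr0.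
have al : alpha gamma p = row4 0 axis.
  rewrite /alpha a0 /alphav momentum_rest dot0r mul0r scaler0 subr0.
  by rewrite vect_row4 enorm_axis// scalerA mulVf ?scale1r// gt_eqF.
have be : beta gamma p = row4 (-1) 0.
  by rewrite /beta /beta0 /betav momentum_rest dot0r mulr0 scaler0 add0r.
rewrite /Phi a0 sin0 cos0 al be !scale0r !scale1r add0r addr0.
rewrite scalerN -scaleNr; congr (_, - (_ / Num.sqrt _) *: _).
rewrite /energy momentum_rest enorm_sqr dot0r mulr0 add0r scal_row4 vect_row4.
by rewrite enorm_axis//; ring.
Qed.

(** On the sphere at the angle pi/4 (the meaning of 2 c^2 = 1), the gnomonic
    coordinate is 1 and the momentum is the speed t; the phase is then t / nu
    with nu = gamma / sqrt (2 gamma - t^2). *)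
Lemma vect_Phi_moving (c t : R) : 0 < c -> 2 * c ^+ 2 = 1 ->
  let phi := t * (Num.sqrt (2 * gamma - t ^+ 2) / gamma) in
  vect (Phi gamma (row4 c (c *: axis), row4 (- (t * c)) ((t * c) *: axis))).1 0 0
  = sin phi * (1 - t ^+ 2 / gamma) + cos phi * phi.
Proof.
move=> c0 c2 phi; set p := (_, _).
have cn0 : c != 0 by rewrite gt_eqF.
have g0 : gamma != 0 by rewrite gt_eqF.
have m : momentum p = t *: axis.
  rewrite momentum_planar; congr (_ *: _).
  by rewrite mulNr opprK -[RHS]mulr1 -c2; ring.
have sp : scal p.1 = c by rewrite scal_row4.
have vp : vect p.1 = c *: axis by rewrite vect_row4.
have nuE : nu gamma p = gamma / Num.sqrt (2 * gamma - t ^+ 2).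
  congr (_ / Num.sqrt _); rewrite /energy m enorm_sqr dotZl dotZr dot_axis_axis.
  by rewrite sp vp enorm_axis// divff//; field.
have tnu : t / nu gamma p = phi by rewrite nuE invf_div.
have a0 : alpha0 gamma p = phi.
  rewrite /alpha0 sp vp m dotZl dotZr dot_axis_axis -tnu.
  by rewrite invfM; move: (nu _ _)^-1 => s; field.
rewrite /Phi a0 /= !row4Z row4D vect_row4 /alphav /betav sp vp m.
rewrite enorm_axis// dotZl dotZr dot_axis_axis !mxE /= -tnu.
rewrite [(nu _ _ * c)^-1]invfM; move: (nu _ _)^-1 (sin _) (cos _) => s x y.
by field; rewrite cn0 g0.
Qed.
End Planar.

(** * Two derivatives at time zero *)

Section Calculus.
Context (R : realType) (gamma : R) (gamma_gt0 : 0 < gamma).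

Let dcst (a : R) : is_derive (0 : R) 1 (fun _ : R => a) 0.
Proof. exact: is_derive_cst. Qed.

Let did : is_derive (0 : R) 1 (fun t : R => t) 1.
Proof. exact: is_derive_id. Qed.

Let dB (f g : R -> R) df dg : is_derive (0 : R) 1 f df ->
  is_derive (0 : R) 1 g dg ->
  is_derive (0 : R) 1 (fun t => f t - g t) (df - dg).
Proof. by move=> ? ?; exact: is_deriveB. Qed.

Let dM (f g : R -> R) df dg : is_derive (0 : R) 1 f df ->
  is_derive (0 : R) 1 g dg ->
  is_derive (0 : R) 1 (fun t => f t * g t) (f 0 * dg + g 0 * df).
Proof. by move=> ? ?; exact: is_deriveM. Qed.

Let dV (f : R -> R) df : f 0 != 0 -> is_derive (0 : R) 1 f df ->
  is_derive (0 : R) 1 (fun t => (f t)^-1) (- (f 0) ^- 2 * df).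
Proof. by move=> ? ?; exact: is_deriveV. Qed.

Let dsqrt (f : R -> R) df : 0 < f 0 -> is_derive (0 : R) 1 f df ->
  is_derive (0 : R) 1 (fun t => Num.sqrt (f t)) ((2 * Num.sqrt (f 0))^-1 * df).
Proof. by move=> f0 fd; exact: is_derive1_comp (is_derive1_sqrt f0) fd. Qed.

(** The phase has derivative sqrt (2 gamma) / gamma = 1 / nu at t = 0, and it
    contributes twice: through the sine and through the factor beta. *)
Lemma is_derive_moving_coord :
  is_derive (0 : R) 1 (fun t : R =>
    let phi := t * (Num.sqrt (2 * gamma - t ^+ 2) / gamma) in
    sin phi * (1 - t ^+ 2 / gamma) + cos phi * phi)
  (2 * (Num.sqrt (2 * gamma) / gamma)).
Proof.
have dsq : is_derive (0 : R) 1 (fun t : R => t ^+ 2) 0.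
  by apply: (is_derive_eq (dM did did)); rewrite !mul0r addr0.
(* The derivative of the square root enters that of the phase multiplied by
   t = 0, hence stays unsimplified. *)
have g2 : 0 < 2 * gamma - 0 ^+ 2 by rewrite expr0n subr0 mulr_gt0.
have dS := dM (dsqrt g2 (dB (dcst (2 * gamma)) dsq)) (dcst gamma^-1).
have := dM did dS; cbv beta.
rewrite mul0r add0r mulr1 expr0n /= subr0.
set phi := (fun t => t * _); set S := Num.sqrt _ / gamma => dphi.
have phi0 : phi 0 = 0 by rewrite /phi mul0r.
have dsin : is_derive (0 : R) 1 (fun t => sin (phi t)) S.
  apply: (is_derive_eq (is_derive1_comp (g := phi) (is_derive_sin _) dphi)).
  by rewrite phi0 cos0 mul1r.
have dcos : is_derive (0 : R) 1 (fun t => cos (phi t)) 0.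
  apply: (is_derive_eq (is_derive1_comp (g := phi) (is_derive_cos _) dphi)).
  by rewrite phi0 sin0 oppr0 mul0r.
have dA := dB (dcst 1) (dM dsq (dcst gamma^-1)).
apply: (is_derive_eq (is_deriveD (dM dsin dA) (dM dcos dphi))).
by rewrite phi0 sin0 cos0 expr0n /=; ring.
Qed.

(** Moving by t along the tangent line at pi/4 changes the gnomonic coordinate
    from 1 to (1 + t) / (1 - t). As nu is proportional to its square root, the
    logarithmic derivative of nu at t = 0 is 1. *)
Lemma is_derive_rest_coord :
  is_derive (0 : R) 1
    (fun t : R => - (gamma / Num.sqrt (2 * gamma * ((1 - t) / (1 + t)))))
    (- (gamma / Num.sqrt (2 * gamma))).
Proof.
have g20 : 0 < 2 * gamma by rewrite mulr_gt0.
have q0 : 0 < 2 * gamma * ((1 - 0) / (1 + 0) : R) by rewrite subr0 addr0 divr1 mulr1.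
have sq0 : Num.sqrt (2 * gamma * ((1 - 0) / (1 + 0))) != 0 by rewrite gt_eqF ?sqrtr_gt0.
have dD : is_derive (0 : R) 1 (fun t : R => 1 + t) (0 + 1) := is_deriveD (dcst 1) did.
have D0 : (1 + 0 : R) != 0 by rewrite addr0.
have dq := dM (dcst (2 * gamma)) (dM (dB (dcst 1) did) (dV D0 dD)).
apply: (is_derive_eq (is_deriveN (dM (dcst gamma) (dV sq0 (dsqrt q0 dq))))).
rewrite subr0 addr0 divr1 mulr1.
have sg : Num.sqrt (2 * gamma) ^+ 2 = 2 * gamma by rewrite sqr_sqrtr// ltW.
have sg0 : Num.sqrt (2 * gamma) != 0 by rewrite gt_eqF// sqrtr_gt0.
move: (Num.sqrt _) sg sg0 => s sg sg0; by rewrite -sg; field.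
Qed.
End Calculus.

(** * The distortion of the symplectic form *)

(** The point p is at rest at the angle pi/4 from the pole; u changes its angle at
    zero speed and w its speed at fixed angle, both along the same great
    circle. *)
Section Witness.
Context (R : realType) (gamma : R) (gamma_gt0 : 0 < gamma).

Let c : R := Num.sqrt 2^-1.
Let e := axis R.
Let a : 'rV[R]_4 := row4 c (c *: e).
Let b : 'rV[R]_4 := row4 (- c) (c *: e).
Let p : R8 R := (a, 0).
Let u : R8 R := (b, 0).
Let w : R8 R := (0, b).

Let c0 : 0 < c. Proof. by rewrite sqrtr_gt0 invr_gt0. Qed.
Let c2 : 2 * c ^+ 2 = 1. Proof. by rewrite sqr_sqrtr ?invr_ge0// divff. Qed.
Let c1 : c < 1.
Proof. by rewrite -(@ltr_pXn2r _ 2) ?nnegrE ?ltW// expr1n; move: c2; lra. Qed.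

Let dot_aa : dot a a = 1.
Proof.
by rewrite dot_row4 dotZl dotZr dot_axis_axis mulr1 -c2; ring.
Qed.

Let dot_bb : dot b b = 1.
Proof.
by rewrite dot_row4 dotZl dotZr dot_axis_axis mulr1 -c2; ring.
Qed.

Let dot_ab : dot a b = 0.
Proof. by rewrite dot_row4 dotZl dotZr dot_axis_axis; ring. Qed.

Lemma Pminus_rest (q : 'rV[R]_4) : dot q q = 1 -> 0 < scal q < 1 ->
  Pminus gamma (q, 0).
Proof.
move=> qq /andP[q0 q1]; split => //=.
- by split => //=; rewrite dot0r.
- by move=> q1'; rewrite q1' ltxx in q1.
- by move=> q1'; move: q0; rewrite q1' ltr0N1.
rewrite /energy momentum_rest enorm_sqr dot0r mulr0 add0r oppr_lt0.
rewrite mulr_gt0// divr_gt0//= enorm_gt0; move: qq; rewrite dot4E.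
have : scal q * scal q < 1 by rewrite -expr2 expr_lt1 // ltW.
lra.
Qed.

Let pP : Pminus gamma p.
Proof. by apply: Pminus_rest => //; rewrite scal_row4 c0 c1. Qed.

Let dcst4 (x : R8 R) : is_derive (0 : R) 1 (fun _ : R => x) 0.
Proof. exact: is_derive_cst. Qed.

(* The straight line p + t u leaves the sphere, hence the great circle. *)
Let tangent_u : tangent (Pminus gamma) p u.
Proof.
pose q t := cos t *: a + sin t *: b.
have qE t : cos t *: p + sin t *: u = (q t, 0).
  by congr (_, _); rewrite /= !scaler0 addr0.
exists (fun t => cos t *: p + sin t *: u); split.
- by rewrite cos0 sin0 scale1r scale0r addr0.
- have qq t : dot (q t) (q t) = 1.
    rewrite !(dotDl, dotDr, dotZl, dotZr) dot_aa dot_bb dot_ab (dotC b) dot_ab.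
    have := sin2cos2 t => s2; ring: s2.
  have sE : (fun t => scal (q t)) = (fun t => cos t * c - sin t * c).
    by apply/funext => t; rewrite /q !row4Z row4D scal_row4; ring.
  have sc : {for 0, continuous (fun t => scal (q t))}.
    rewrite sE; apply: cvgB; apply: cvgM; try exact: cvg_cst.
      exact: continuous_cos.
    exact: continuous_sin.
  have s0 : scal (q 0) = c by rewrite -[LHS]/((fun t => scal (q t)) 0) sE cos0 sin0; ring.
  near=> t; rewrite qE; apply: Pminus_rest => //; apply/andP; split; near: t.
    by apply: (cvgr_gt _ sc); rewrite s0.
  by apply: (cvgr_lt _ sc); rewrite s0.
apply: (is_derive_eq (is_deriveD (is_derive_scalel (V := R8 R) p (is_derive_cos 0))
  (is_derive_scalel (V := R8 R) u (is_derive_sin 0)))).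
by rewrite sin0 cos0 oppr0 scale0r scale1r add0r.
Unshelve. all: by end_near. Qed.

Let line_w t : t *: w + p = (row4 c (c *: e), row4 (- (t * c)) ((t * c) *: e)).
Proof. by congr (_, _); rewrite /= ?scaler0 ?add0r// addr0 row4Z mulrN scalerA. Qed.

Let tangent_w : tangent (Pminus gamma) p w.
Proof.
exists (fun t => t *: w + p); split.
- by rewrite scale0r add0r.
- near=> t; have t2 : t ^+ 2 < 2 * gamma.
    near: t.
    have tc : {for 0, continuous (fun t : R => t ^+ 2)} by exact: exprn_continuous.
    by apply: (cvgr_lt _ tc); rewrite expr0n mulr_gt0.
  have lE := line_w t.
  split.
  + split; rewrite lE.
      by rewrite /= dot_aa.
    by rewrite /= dot_row4 dotZl dotZr dot_axis_axis; ring.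
  + by rewrite lE scal_row4 => c1'; move: c1; rewrite c1' ltxx.
  + by rewrite lE scal_row4 => c1'; move: c0; rewrite c1' ltr0N1.
  rewrite lE /energy momentum_planar enorm_sqr dotZl dotZr dot_axis_axis.
  rewrite scal_row4 vect_row4 enorm_axis// divff ?gt_eqF//.
  have -> : c * (t * c) - - (t * c) * c = t by rewrite -[RHS]mulr1 -c2; ring.
  by move: t2; rewrite expr2; lra.
apply: (is_derive_eq (is_deriveD
  (is_derive_scalel (V := R8 R) w (is_derive_id _ _)) (dcst4 p))).
by rewrite addr0 scale1r.
Unshelve. all: by end_near. Qed.

Let dPhi : differentiable (Phi gamma) p.
Proof. exact: differentiable_Phi. Qed.

Let line_u t : t *: u + p = (row4 (c * (1 - t)) ((c * (1 + t)) *: e), 0).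
Proof.
congr (_, _); rewrite /= ?scaler0 ?add0r// row4Z row4D scalerA -scalerDl.
by congr (row4 _ (_ *: _)); ring.
Qed.

Let line_u_Phi : \forall t \near (0 : R), Phi gamma (t *: u + p) =
  (row4 (-1) 0, - (gamma / Num.sqrt (2 * gamma * ((1 - t) / (1 + t)))) *: row4 0 e).
Proof.
near=> t; have t1 : 0 < 1 + t.
  near: t; have tc : {for 0, continuous (fun t : R => 1 + t)}.
    by apply: cvgD; [exact: cvg_cst | exact: cvg_id].
  by apply: (cvgr_gt _ tc); rewrite addr0.
rewrite line_u Phi_rest ?mulr_gt0//.
by rewrite -mulf_div divff ?gt_eqF// mul1r.
Unshelve. all: by end_near. Qed.

Let diff_u1 : ('d (Phi gamma) p u).1 = 0.
Proof.
rewrite -diff_fst//; have [_ <-] := is_derive_line u (differentiable_fst dPhi).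
have [_ <-] := is_derive_cst (row4 (-1) 0 : 'rV[R]_4) (0 : R) 1.
by apply: near_eq_derive; apply: filterS line_u_Phi => t ->.
Qed.

Let diff_u2 : ('d (Phi gamma) p u).2 = - (gamma / Num.sqrt (2 * gamma)) *: row4 0 e.
Proof.
rewrite -diff_snd//; have [_ <-] := is_derive_line u (differentiable_snd dPhi).
have [_ <-] := is_derive_scalel (row4 0 e) (is_derive_rest_coord gamma_gt0).
by apply: near_eq_derive; apply: filterS line_u_Phi => t ->.
Qed.

Let diff_w1 : vect ('d (Phi gamma) p w).1 0 0 = 2 * (Num.sqrt (2 * gamma) / gamma).
Proof.
have d1 := differentiable_fst dPhi.
rewrite -diff_fst// mxE -diff_entry//.
have [_ <-] := is_derive_line w (differentiable_entry 0 (rshift 1 (0 : 'I_3)) d1).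
have [_ <-] := is_derive_moving_coord gamma_gt0.
congr ('D_ _ _ _); apply/funext => t.
rewrite -[RHS](vect_Phi_moving gamma_gt0 t c0 c2) line_w.
by rewrite [RHS]mxE.
Qed.

(** The image of u has no first component, so the form reduces to the product of
    the x-derivative 2 / nu along w and the derivative nu of the radius along
    u. *)
Lemma omega_Phi : omega ('d (Phi gamma) p u) ('d (Phi gamma) p w) = 2.
Proof.
rewrite /omega diff_u1 diff_u2 dotC dot0r dotZr dot4E scal_row4 vect_row4.
rewrite dot_axis diff_w1 mulr0 !add0r mulNr opprK.
rewrite mulrCA mulf_div [gamma * _]mulrC divff ?mulr1//.
by rewrite mulf_neq0// gt_eqF// sqrtr_gt0 mulr_gt0.
Qed.

Lemma omega_u_w : omega u w = 1.
Proof. by rewrite /omega /= dot_bb dot0r subr0. Qed.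

Lemma not_symplectic_Phi :
  ~ symplectic_map (Pminus gamma) (@TplusS3 R) (Phi gamma).
Proof.
move=> [_ _ /(_ p u w pP tangent_u tangent_w)].
by rewrite omega_Phi omega_u_w => /eqP; rewrite (eqr_nat R 2 1).
Qed.
End Witness.

Unset Implicit Arguments.

Theorem corollary6p6 (R : realType) (gamma : R) (gamma_gt0 : 0 < gamma) :
  [/\ forall p : R8 R, Pminus gamma p -> TplusS3 (Phi gamma p),
      forall p : R8 R, Pminus gamma p -> differentiable (Phi gamma) p &
      ~ symplectic_map (Pminus gamma) (@TplusS3 R) (Phi gamma)].
Proof.
split; [exact: Phi_TplusS3|exact: differentiable_Phi|].
exact: not_symplectic_Phi.
Qed.
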